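(* Let $(X_1,Y_1),\ldots,(X_n,Y_n)$ be random vectors in $\mathbb{R}^p\times\mathbb{R}$ and let $k$ be any integer with $1\le k\le p$ such that $\mathrm{RIP}_n(k)\le\Lambda_n(k)$. Then $$\sup_{M\in\mathcal{M}(k)}\left\|\hat\beta_{n,M}-\beta_{n,M}-\frac1n\sum_{i=1}^n[\Sigma_n(M)]^{-1}X_i(M)\big(Y_i-X_i^\top(M)\beta_{n,M}\big)\right\|_2\le\frac{\mathrm{RIP}_n(k)}{\Lambda_n(k)}\left(\frac{\mathcal{D}_n(k)+\mathrm{RIP}_n(k)\,S_{2,k}(\Sigma_n,\Gamma_n)}{\Lambda_n(k)-\mathrm{RIP}_n(k)}\right).$$ (The inequality is deterministic.)
   Context: $\mathcal{M}(k)=\{M\subseteq\{1,\ldots,p\}:1\le|M|\le k\}$. For $v\in\mathbb{R}^p$, $v(M)$ is the subvector with indices in $M$; for a symmetric $A\in\mathbb{R}^{p\times p}$, $A(M)$ is the submatrix with indices in $M\times M$. $\|\theta\|_0$ is the number of non-zero entries of $\theta$. Set $\hat\Sigma_n=\frac1n\sum_{i=1}^nX_iX_i^\top$, $\hat\Gamma_n=\frac1n\sum_{i=1}^nX_iY_i$, $\Sigma_n=\frac1n\sum_{i=1}^n\mathbb{E}[X_iX_i^\top]$, $\Gamma_n=\frac1n\sum_{i=1}^n\mathbb{E}[X_iY_i]$; $\Sigma_n$ and $\Gamma_n$ are non-random. The least squares estimator and its target for submodel $M$ are $\hat\beta_{n,M}=[\hat\Sigma_n(M)]^{-1}\hat\Gamma_n(M)$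 and $\beta_{n,M}=[\Sigma_n(M)]^{-1}\Gamma_n(M)$, the inverses being assumed to exist. Define $\mathrm{RIP}_n(k)=\sup_{M\in\mathcal{M}(k)}\|\hat\Sigma_n(M)-\Sigma_n(M)\|_{op}$ (operator norm with respect to $\|\cdot\|_2$), $\mathcal{D}_n(k)=\sup_{M\in\mathcal{M}(k)}\|\hat\Gamma_n(M)-\Gamma_n(M)\|_2$, $\Lambda_n(k)=\inf_{0\ne\theta\in\mathbb{R}^p,\,\|\theta\|_0\le k}\|\Sigma_n\theta\|_2/\|\theta\|_2$, and $S_{2,k}(\Sigma_n,\Gamma_n)=\sup_{M\in\mathcal{M}(k)}\|\beta_{n,M}\|_2$. No independence, identical distribution or linear model is assumed.
   Formalization: Λ_n(k) is taken with Σ_nθ restricted to the rows in the support of θ (the least singular value of Σ_n(M) over M in M(k)), since with all p rows the inequality fails; if RIP_n(k)=Λ_n(k), the quotient by 0 is +∞ (0 if its numerator is 0). *)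

(* Defs.v *)
From HB Require Import structures.
From mathcomp Require Import all_boot all_order all_algebra.
From mathcomp Require Import all_classical all_reals all_analysis.
Set Implicit Arguments.
Unset Strict Implicit.
Unset Printing Implicit Defensive.
Import Order.TTheory GRing.Theory Num.Theory.
Import numFieldNormedType.Exports.
Local Open Scope classical_set_scope.
Local Open Scope ring_scope.

Section Norms.
Variable R : realType.

(* The norm that MathComp-Analysis puts on matrices is the max norm. *)
Definition l2norm m (v : 'cV[R]_m) : R := Num.sqrt (\sum_i v i ord0 ^+ 2).

Definition opnorm m (A : 'M[R]_m) : R :=
  sup [set l2norm (A *m v) | v in [set v : 'cV[R]_m | l2norm v <= 1]].

End Norms.

Section Submodels.
Variables (R : realType) (p : nat).
Implicit Types (M : {set 'I_p}) (A B : 'M[R]_p) (v g h theta : 'cV[R]_p).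

Definition submodels (k : nat) : set {set 'I_p} :=
  [set M | (1 <= #|M| <= k)%N].

Definition subvec v M : 'cV[R]_#|M| :=
  \col_(i < #|M|) v (enum_val i) ord0.

Definition submat A M : 'M[R]_#|M| :=
  \matrix_(i < #|M|, j < #|M|) A (enum_val i) (enum_val j).

Definition supp theta : {set 'I_p} := [set i | theta i ord0 != 0]%SET.

(* [A(M)]^-1 g(M); [invmx] is the inverse only when [submat A M] is a unit. *)
Definition ls_coef A g M : 'cV[R]_#|M| :=
  invmx (submat A M) *m subvec g M.

Definition RIP (k : nat) A B : R :=
  sup [set opnorm (submat A M - submat B M) | M in submodels k].

Definition Dsup (k : nat) g h : R :=
  sup [set l2norm (subvec g M - subvec h M) | M in submodels k].

Definition S2 (k : nat) A g : R :=
  sup [set l2norm (ls_coef A g M) | M in submodels k].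

(* The minimal k-sparse singular value of A: the smallest singular value of
   A(M) over the submodels M of size at most k.  For a k-sparse theta, A acts
   as the submatrix indexed by the support of theta.  Keeping all p rows of
   A *m theta instead would give a larger quantity, which does not satisfy
   ||A(M)^-1||_op <= 1 / Lambda k A: for A = [[2, 2], [2, 2]] and k = 1 it is
   sqrt 8, while A(M) = 2. *)
Definition Lambda (k : nat) A : R :=
  inf [set l2norm (submat A (supp theta) *m subvec theta (supp theta))
           / l2norm theta
      | theta in [set theta | theta != 0 /\ (#|supp theta| <= k)%N]].

End Submodels.

Section Moments.
Context (R : realType) (d : measure_display) (T : measurableType d)
  (P : probability T R) (n p : nat).
Variables (X : 'I_n -> 'I_p -> {RV P >-> R}) (Y : 'I_n -> {RV P >-> R}).

Definition Xvec (i : 'I_n) (w : T) : 'cV[R]_p := \col_a X i a w.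

Definition Sigma_hat (w : T) : 'M[R]_p :=
  n%:R^-1 *: \sum_(i < n) Xvec i w *m (Xvec i w)^T.

Definition Gamma_hat (w : T) : 'cV[R]_p :=
  n%:R^-1 *: \sum_(i < n) Y i w *: Xvec i w.

(* ['E_P[_]] is extended-real; it is finite under [moments_exist]. *)
Definition Sigma : 'M[R]_p :=
  n%:R^-1 *: \sum_(i < n) \matrix_(a, b) fine 'E_P[X i a \* X i b].

Definition Gamma : 'cV[R]_p :=
  n%:R^-1 *: \sum_(i < n) \col_a fine 'E_P[X i a \* Y i].

Definition moments_exist : Prop :=
  (forall i a b, P.-integrable setT (EFin \o (X i a \* X i b))) /\
  (forall i a, P.-integrable setT (EFin \o (X i a \* Y i))).

Definition linear_term (w : T) (M : {set 'I_p}) : 'cV[R]_#|M| :=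
  n%:R^-1 *: \sum_(i < n)
    (Y i w - ((subvec (Xvec i w) M)^T *m ls_coef Sigma Gamma M) ord0 ord0)
      *: (invmx (submat Sigma M) *m subvec (Xvec i w) M).

End Moments.

(* Main.v *)
Require Import Defs.
From HB Require Import structures.
From mathcomp Require Import all_boot all_order all_algebra.
From mathcomp Require Import all_classical all_reals all_analysis.
Import Order.TTheory GRing.Theory Num.Theory.
Import numFieldNormedType.Exports.
Local Open Scope classical_set_scope.
Local Open Scope ring_scope.

(** For one submodel [M], write [A], [B] for [Sigma_hat(M)], [Sigma(M)] and
    [a], [b] for [Gamma_hat(M)], [Gamma(M)], and let [bhat = A^-1 a],
    [beta = B^-1 b].  The linear term is [B^-1 (a - A beta)], and since
    [a = A bhat] it equals [B^-1 A (bhat - beta)].  Two exact identities follow: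

      bhat - beta - B^-1 (a - A beta) = B^-1 (B - A) (bhat - beta),
      A (bhat - beta) = (a - b) - (A - B) beta

    ([linearization_error], [estimation_error]).  By definition of the suprema,
    [A - B] expands norms by at most [rip], [a - b] has norm at most [D] and
    [beta] at most [S]; and [B] expands norms by at least [lam] ([Lambda_le]),
    hence [A] expands them by at least [lam - rip].  The second identity thus
    bounds [bhat - beta] by [(D + rip S) / (lam - rip)], and the first one turns
    this into the bound on the linearization error, at the cost of a factor
    [rip / lam] ([linearization_error_bound]).

    With extended-real division the denominators may vanish.  A quotient
    [y / 0] is infinite, and harmless as an upper bound, unless [y = 0]; in
    that case [A (bhat - beta) = 0], so [bhat = beta] because [A] is invertible,
    respectively [(B - A) (bhat - beta) = 0], so the linearization error is zero
    ([lee_pdivl] isolates this side condition).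

    All suprema over submodels range over finite sets, and the one in the
    operator norm over a bounded set, so each dominates its members. *)

(** * The Euclidean norm *)

Section EuclideanNorm.
Context {R : realType}.

Lemma l2norm_ge0 {m} (v : 'cV[R]_m) : 0 <= l2norm v.
Proof. exact: sqrtr_ge0. Qed.

Lemma sqr_l2norm {m} (v : 'cV[R]_m) : l2norm v ^+ 2 = \sum_i v i ord0 ^+ 2.
Proof. by rewrite sqr_sqrtr// sumr_ge0// => i _; exact: sqr_ge0. Qed.

Lemma l2normZ {m} (c : R) (v : 'cV[R]_m) : l2norm (c *: v) = `|c| * l2norm v.
Proof.
rewrite -sqrtr_sqr -sqrtrM ?sqr_ge0// mulr_sumr; congr Num.sqrt.
by apply: eq_bigr => i _; rewrite mxE exprMn.
Qed.

Lemma l2norm0 {m} : l2norm (0 : 'cV[R]_m) = 0.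
Proof. by rewrite -[0 in LHS](scale0r 0) l2normZ normr0 mul0r. Qed.

Lemma normr_le_l2norm {m} (v : 'cV[R]_m) i : `|v i ord0| <= l2norm v.
Proof.
rewrite -sqrtr_sqr ler_wsqrtr// (bigD1 i)//= lerDl.
by rewrite sumr_ge0// => j _; exact: sqr_ge0.
Qed.

Lemma l2norm_eq0 {m} (v : 'cV[R]_m) : (l2norm v == 0) = (v == 0).
Proof.
apply/eqP/eqP => [v0|->]; last exact: l2norm0.
apply/colP => i; rewrite mxE; apply/eqP; rewrite -normr_le0 -v0.
exact: normr_le_l2norm.
Qed.

(** Cauchy-Schwarz: each term obeys [2 ab u_i v_i <= b^2 u_i^2 + a^2 v_i^2]
    with [a] and [b] the two norms, and the right-hand sides add up to
    [2 a^2 b^2]. *)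
Lemma dot_le_l2norm {m} (u v : 'cV[R]_m) :
  \sum_i u i ord0 * v i ord0 <= l2norm u * l2norm v.
Proof.
have [->|u0] := eqVneq u 0.
  by rewrite l2norm0 mul0r big1// => i _; rewrite mxE mul0r.
have [->|v0] := eqVneq v 0.
  by rewrite l2norm0 mulr0 big1// => i _; rewrite mxE mulr0.
have a0 : 0 < l2norm u by rewrite lt0r l2norm_eq0 u0 l2norm_ge0.
have b0 : 0 < l2norm v by rewrite lt0r l2norm_eq0 v0 l2norm_ge0.
rewrite -(ler_pM2l (mulr_gt0 b0 a0)) -(@ler_pMn2r _ 2)// mulr_sumr.
have -> : l2norm v * l2norm u * (l2norm u * l2norm v) *+ 2 =
    \sum_i ((l2norm v * u i ord0) ^+ 2 + (l2norm u * v i ord0) ^+ 2).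
  rewrite big_split/= !(eq_bigr _ (fun i _ => exprMn _ _ _)) -!mulr_sumr.
  by rewrite -!sqr_l2norm -!exprMn [l2norm v * _]mulrC -mulr2n.
rewrite -sumrMnl; apply: ler_sum => i _.
by rewrite mulrACA -subr_ge0 addrAC -sqrrB sqr_ge0.
Qed.

Lemma l2normD_le {m} (u v : 'cV[R]_m) : l2norm (u + v) <= l2norm u + l2norm v.
Proof.
rewrite -ler_sqr ?nnegrE ?addr_ge0 ?l2norm_ge0//.
rewrite sqrrD !sqr_l2norm (eq_bigr (fun i => u i ord0 ^+ 2 +
  (u i ord0 * v i ord0) *+ 2 + v i ord0 ^+ 2)); last first.
  by move=> i _; rewrite mxE sqrrD.
by rewrite !big_split/= lerD2r lerD2l -mulr2n lerMn2r dot_le_l2norm.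
Qed.

Lemma l2normB_le {m} (u v : 'cV[R]_m) : l2norm (u - v) <= l2norm u + l2norm v.
Proof.
by rewrite (le_trans (l2normD_le _ _))// -scaleN1r l2normZ normrN1 mul1r.
Qed.

End EuclideanNorm.

(** * The operator norm *)

Section OperatorNorm.
Context {R : realType}.

(** A supremum in the reals bounds the members of a set only if that set is
    bounded above; on the unit ball this holds because every coordinate of
    the vector is at most 1 in absolute value. *)
Lemma opnorm_has_ubound {m} (A : 'M[R]_m) :
  has_ubound [set l2norm (A *m v) | v in [set v : 'cV[R]_m | l2norm v <= 1]].
Proof.
exists (Num.sqrt (\sum_i (\sum_j `|A i j|) ^+ 2)) => _ [v v1 <-].
rewrite ler_wsqrtr// ler_sum// => i _.
rewrite -[leLHS]real_normK ?num_real// ler_sqr ?nnegrE ?sumr_ge0// mxE.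
rewrite (le_trans (ler_norm_sum _ _ _))// ler_sum// => j _.
by rewrite normrM ler_piMr// (le_trans (normr_le_l2norm v j)).
Qed.

Lemma opnorm_ge0 {m} (A : 'M[R]_m) : 0 <= opnorm A.
Proof.
apply: (ub_le_sup (opnorm_has_ubound A)); exists 0 => /=.
  by rewrite l2norm0.
by rewrite mulmx0 l2norm0.
Qed.

Lemma l2norm_mulmx_le {m} (A : 'M[R]_m) (v : 'cV[R]_m) :
  l2norm (A *m v) <= opnorm A * l2norm v.
Proof.
have [->|v0] := eqVneq v 0; first by rewrite mulmx0 l2norm0 mulr0.
have nv0 : 0 < l2norm v by rewrite lt0r l2norm_eq0 v0 l2norm_ge0.
rewrite -ler_pdivrMr//.
apply: (ub_le_sup (opnorm_has_ubound A)); exists ((l2norm v)^-1 *: v) => /=.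
  by rewrite l2normZ ger0_norm ?invr_ge0 ?l2norm_ge0// mulVf// gt_eqF.
by rewrite -scalemxAr l2normZ ger0_norm ?invr_ge0 ?l2norm_ge0// mulrC.
Qed.

End OperatorNorm.

(** * Submodels and sparse vectors *)

Section Submodels.
Context {R : realType} {p : nat}.
Implicit Types (M : {set 'I_p}) (A B : 'M[R]_p) (x g h theta : 'cV[R]_p).

Lemma subvecE x M : subvec x M = rowsub enum_val x.
Proof. by apply/colP => i; rewrite !mxE. Qed.

Lemma submatE A M : submat A M = mxsub enum_val enum_val A.
Proof. by apply/matrixP => i j; rewrite !mxE. Qed.

Lemma sqr_l2norm_subvec x M :
  l2norm (subvec x M) ^+ 2 = \sum_(i in M) x i ord0 ^+ 2.
Proof.
rewrite sqr_l2norm (big_enum_val (A := mem M))/=.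
by apply: eq_bigr => i _; rewrite mxE.
Qed.

Lemma l2norm_subvec_subset x (M N : {set 'I_p}) :
  M \subset N -> l2norm (subvec x M) <= l2norm (subvec x N).
Proof.
move=> MN; rewrite -ler_sqr ?nnegrE ?l2norm_ge0// !sqr_l2norm_subvec.
rewrite [leRHS](big_setID M)/= (finset.setIidPr MN) lerDl.
by rewrite sumr_ge0// => i _; exact: sqr_ge0.
Qed.

Lemma notin_supp theta M i :
  supp theta \subset M -> i \notin M -> theta i ord0 = 0.
Proof.
move=> /fintype.subsetP sM iM; apply/eqP; apply: contraNT iM => ti.
by apply: sM; rewrite inE.
Qed.

Lemma l2norm_subvec_supp theta M :
  supp theta \subset M -> l2norm (subvec theta M) = l2norm theta.
Proof.
move=> sM; apply: (@pexpIrn _ 2); rewrite ?nnegrE ?l2norm_ge0//.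
rewrite sqr_l2norm_subvec sqr_l2norm [RHS](bigID (mem M))/= [X in _ + X]big1.
  by rewrite addr0.
by move=> i iM; rewrite (notin_supp theta M)// expr0n.
Qed.

(** The columns of [A] outside [M] are multiplied by zero entries. *)
Lemma submat_mul_subvec A theta M :
  supp theta \subset M ->
  submat A M *m subvec theta M = subvec (A *m theta) M.
Proof.
move=> sM; apply/colP => i; rewrite !mxE.
rewrite [RHS](bigID (mem M))/= [X in _ = _ + X]big1 ?addr0.
  by rewrite (big_enum_val (A := mem M))/=; apply: eq_bigr => j _; rewrite !mxE.
by move=> j jM; rewrite (notin_supp theta M)// mulr0.
Qed.

(** The extension of [v] by zero outside [M]; it transports the bound that
    [Lambda] gives for sparse vectors of full dimension to the vectors of a
    submodel. *)
Lemma subvec_extension M (v : 'cV[R]_#|M|) :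
  exists2 theta : 'cV[R]_p, supp theta \subset M & subvec theta M = v.
Proof.
(* The rows of this 0-1 matrix are the unit vectors indexed by [M]. *)
exists ((rowsub enum_val 1%:M)^T *m v).
  apply/fintype.subsetP => i; rewrite inE; apply: contraR => iM.
  rewrite mxE big1// => j _; rewrite !mxE.
  have [ij|] := eqVneq (enum_val j) i; last by rewrite mul0r.
  by rewrite -ij enum_valP in iM.
apply/colP => i; rewrite !mxE (bigD1 i)//= big1 ?addr0.
  by rewrite !mxE eqxx mul1r.
move=> j /negPf ji; rewrite !mxE.
by rewrite (inj_eq enum_val_inj) ji mul0r.
Qed.

Lemma le_sup_finite (T : finType) (D : set T) (f : T -> R) t :
  D t -> f t <= sup [set f s | s in D].
Proof.
move=> Dt; apply: ub_le_sup; last by exists t.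
exists (\sum_s `|f s|) => _ [s _ <-].
by rewrite (le_trans (ler_norm _))// (bigD1 s)//= lerDl sumr_ge0.
Qed.

Lemma opnorm_le_RIP k A B M :
  submodels k M -> opnorm (submat A M - submat B M) <= RIP k A B.
Proof. exact: le_sup_finite. Qed.

Lemma l2norm_le_Dsup k g h M :
  submodels k M -> l2norm (subvec g M - subvec h M) <= Dsup k g h.
Proof. exact: le_sup_finite. Qed.

Lemma l2norm_le_S2 k A g M :
  submodels k M -> l2norm (ls_coef A g M) <= S2 k A g.
Proof. exact: le_sup_finite. Qed.

(** [Lambda] only tests a sparse vector against the rows of [A] in its own
    support; the submodel [M] may be larger, but its additional rows can only
    increase the norm of the image. *)
Lemma Lambda_le k A M (v : 'cV[R]_#|M|) :
  submodels k M -> Lambda k A * l2norm v <= l2norm (submat A M *m v).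
Proof.
move=> /andP[_ Mk]; have [theta sM <-] := subvec_extension M v.
have [t0|t0] := eqVneq theta 0.
  by rewrite l2norm_subvec_supp// t0 l2norm0 mulr0 l2norm_ge0.
have nt0 : 0 < l2norm theta by rewrite lt0r l2norm_eq0 t0 l2norm_ge0.
rewrite l2norm_subvec_supp// submat_mul_subvec//.
apply: (@le_trans _ _ (l2norm (subvec (A *m theta) (supp theta)))); last first.
  exact: l2norm_subvec_subset.
rewrite -ler_pdivlMr// -submat_mul_subvec//; apply: ge_inf.
  by exists 0 => _ [x _ <-]; rewrite divr_ge0 ?l2norm_ge0.
by exists theta => //; split=> //; exact: leq_trans (subset_leq_card sM) Mk.
Qed.

End Submodels.

(** * Perturbation of a linear system *)

(** For [c = 0] the quotient [y / c] is infinite if [y > 0], but it is [0] if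
    [y = 0]; the last hypothesis covers that case. *)
Lemma lee_pdivl {R : realType} (c x y : R) :
    0 <= c -> 0 <= y -> c * x <= y -> (y = 0 -> x <= 0) ->
  (x%:E <= y%:E / c%:E)%E.
Proof.
move=> c0 y0 cxy yx; rewrite inver; have [ceq|cn0] := eqVneq c 0.
  have [yeq|yn0] := eqVneq y 0; first by rewrite yeq mul0e lee_fin yx.
  by rewrite gt0_muley ?leey// lte_fin lt0r yn0.
by rewrite -EFinM lee_fin ler_pdivlMr 1?mulrC// lt0r cn0.
Qed.

Section Perturbation.
Context {R : realType} {m : nat}.
Variables (A B : 'M[R]_m) (a b : 'cV[R]_m).
Hypotheses (Au : A \in unitmx) (Bu : B \in unitmx).

Let bhat := invmx A *m a.
Let beta := invmx B *m b.

(** Since [A *m bhat = a], the residual [a - A *m beta] is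
    [A *m (bhat - beta)], and [bhat - beta] itself is
    [invmx B *m (B *m (bhat - beta))]. *)
Lemma linearization_error :
  bhat - beta - invmx B *m (a - A *m beta)
  = invmx B *m ((B - A) *m (bhat - beta)).
Proof.
by rewrite mulmxBl !mulmxBr !mulKmx// mulKVmx.
Qed.

(** Add and subtract [b = B *m beta]. *)
Lemma estimation_error : A *m (bhat - beta) = (a - b) - (A - B) *m beta.
Proof. by rewrite mulmxBr mulmxBl !mulKVmx// opprB addrA subrK. Qed.

(** The two identities control the two factors of the bound: the first factor
    is the loss from [delta := bhat - beta] to the linearization error, and the
    second one bounds [delta], because [A] expands norms by at least
    [lam - rip]. *)
Lemma linearization_error_bound (rip lam D S : R) :
    0 <= rip <= lam -> opnorm (A - B) <= rip ->
    l2norm (a - b) <= D -> l2norm beta <= S ->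
    (forall v, lam * l2norm v <= l2norm (B *m v)) ->
  ((l2norm (bhat - beta - invmx B *m (a - A *m beta)))%:E
   <= (rip%:E / lam%:E) * ((D + rip * S)%:E / (lam - rip)%:E))%E.
Proof.
move=> /andP[rip0 rip_lam] ABrip abD betaS Blow.
have lam0 : 0 <= lam := le_trans rip0 rip_lam.
have D0 : 0 <= D := le_trans (l2norm_ge0 _) abD.
have S0 : 0 <= S := le_trans (l2norm_ge0 _) betaS.
have ABv v : l2norm ((A - B) *m v) <= rip * l2norm v.
  by rewrite (le_trans (l2norm_mulmx_le _ _))// ler_wpM2r// l2norm_ge0.
set delta := bhat - beta.
have Adelta : l2norm (A *m delta) <= D + rip * S.
  rewrite estimation_error (le_trans (l2normB_le _ _))// lerD//.
  by rewrite (le_trans (ABv _))// ler_wpM2l.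
have delta_le : ((l2norm delta)%:E <= (D + rip * S)%:E / (lam - rip)%:E)%E.
  apply: lee_pdivl; rewrite ?subr_ge0 ?addr_ge0 ?mulr_ge0//.
  - rewrite (le_trans _ Adelta)// mulrBl lerBlDr (le_trans (Blow _))//.
    have -> : B *m delta = A *m delta - (A - B) *m delta.
      by rewrite mulmxBl opprB addrC subrK.
    by rewrite (le_trans (l2normB_le _ _))// lerD2l ABv.
  - move=> E0; have : A *m delta == 0.
      by rewrite -l2norm_eq0 eq_le l2norm_ge0 -E0 Adelta.
    by move=> /eqP Ad0; rewrite -(mulKmx Au delta) Ad0 mulmx0 l2norm0.
rewrite linearization_error.
have BAdelta : l2norm ((B - A) *m delta) <= rip * l2norm delta.
  by rewrite -opprB mulNmx -scaleN1r l2normZ normrN1 mul1r ABv.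
apply: (@le_trans _ _ ((rip * l2norm delta)%:E / lam%:E)%E).
  apply: lee_pdivl; rewrite ?mulr_ge0 ?l2norm_ge0//.
  - by rewrite (le_trans (Blow _))// mulKVmx.
  - move=> r0; have : (B - A) *m delta == 0.
      by rewrite -l2norm_eq0 eq_le l2norm_ge0 -r0 BAdelta.
    by move=> /eqP ->; rewrite mulmx0 l2norm0.
rewrite EFinM muleAC lee_wpmul2l//.
by rewrite mule_ge0// ?inve_ge0 lee_fin.
Qed.

End Perturbation.

(** * The linear term of the expansion *)

Section LinearTerm.
Context {R : realType} {d : measure_display} {T : measurableType d}
  {P : probability T R} {n p : nat}.
Variables (X : 'I_n -> 'I_p -> {RV P >-> R}) (Y : 'I_n -> {RV P >-> R}).

Lemma submat_Sigma_hat w (M : {set 'I_p}) :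
  submat (Sigma_hat X w) M =
  n%:R^-1 *: \sum_i subvec (Xvec X i w) M *m (subvec (Xvec X i w) M)^T.
Proof.
rewrite submatE linearZ linear_sum; congr (_ *: _); apply: eq_bigr => i _.
by rewrite /= mxsub_mul !subvecE trmx_mxsub.
Qed.

Lemma subvec_Gamma_hat w (M : {set 'I_p}) :
  subvec (Gamma_hat X Y w) M =
  n%:R^-1 *: \sum_i Y i w *: subvec (Xvec X i w) M.
Proof.
rewrite subvecE linearZ linear_sum; congr (_ *: _); apply: eq_bigr => i _.
by rewrite linearZ subvecE.
Qed.

(** The sum over observations is a residual of the empirical normal equations
    at the target coefficients. *)
Lemma linear_termE w (M : {set 'I_p}) :
  linear_term X Y w M =
  invmx (submat (Sigma X) M) *m
    (subvec (Gamma_hat X Y w) M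
     - submat (Sigma_hat X w) M *m ls_coef (Sigma X) (Gamma X Y) M).
Proof.
rewrite submat_Sigma_hat subvec_Gamma_hat -scalemxAl -scalerBr -scalemxAr.
congr (_ *: _); rewrite mulmx_suml -sumrB mulmx_sumr.
apply: eq_bigr => i _; rewrite scalemxAr scalerBl; congr (_ *m (_ - _)).
by rewrite -mulmxA [X in _ = _ *m X]mx11_scalar mul_mx_scalar.
Qed.

End LinearTerm.

(* Division is that of the extended reals, x / 0 = x * +oo (and 0 * +oo = 0),
   so that the case RIP = Lambda allowed by the hypothesis is covered. *)
Theorem theorem4 (R : realType) (d : measure_display) (T : measurableType d)
    (P : probability T R) (n p k : nat)
    (X : 'I_n -> 'I_p -> {RV P >-> R}) (Y : 'I_n -> {RV P >-> R})
    (n_gt0 : (0 < n)%N) (k_bounds : (1 <= k <= p)%N)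
    (XY_moments : moments_exist X Y)
    (Sigma_unit : forall M : {set 'I_p}, submodels k M ->
       submat (Sigma X) M \in unitmx)
    (w : T)
    (Sigma_hat_unit : forall M : {set 'I_p}, submodels k M ->
       submat (Sigma_hat X w) M \in unitmx)
    (RIP_le_Lambda : RIP k (Sigma_hat X w) (Sigma X) <= Lambda k (Sigma X)) :
  let rip := RIP k (Sigma_hat X w) (Sigma X) in
  let lam := Lambda k (Sigma X) in
  let D := Dsup k (Gamma_hat X Y w) (Gamma X Y) in
  let S := S2 k (Sigma X) (Gamma X Y) in
  ((sup [set l2norm (ls_coef (Sigma_hat X w) (Gamma_hat X Y w) M
                     - ls_coef (Sigma X) (Gamma X Y) M
                     - linear_term X Y w M)
        | M in @submodels p k])%:E
   <= (rip%:E / lam%:E) * ((D + rip * S)%:E / (lam - rip)%:E))%E.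
Proof.
cbv zeta; set rip := RIP _ _ _; set lam := Lambda _ _.
set D := Dsup _ _ _; set S := S2 _ _ _.
set E := [set l2norm _ | M in _].
have bound x : E x ->
    (x%:E <= (rip%:E / lam%:E) * ((D + rip * S)%:E / (lam - rip)%:E))%E.
  move=> [M Mk <-]; rewrite linear_termE; apply: linearization_error_bound.
  - exact: Sigma_hat_unit.
  - exact: Sigma_unit.
  - rewrite RIP_le_Lambda andbT.
    exact: le_trans (opnorm_ge0 _) (opnorm_le_RIP _ _ _ _ Mk).
  - exact: opnorm_le_RIP.
  - exact: l2norm_le_Dsup.
  - exact: l2norm_le_S2.
  - by move=> v; exact: Lambda_le.
have [x0 Ex0] : E !=set0.
  have /andP[k0 kp] := k_bounds.
  pose i0 : 'I_p := Ordinal (leq_trans k0 kp).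
  by apply: image_nonempty; exists [set i0]%SET; rewrite /submodels/= cards1.
(* The right-hand side may be infinite, while [sup] is taken in the reals. *)
move: bound; case: (_ * _)%E => [r| |] bound.
- rewrite lee_fin; apply: ge_sup; first by exists x0.
  by move=> x /bound; rewrite lee_fin.
- exact: leey.
- by have := bound _ Ex0.
Qed.
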